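(* There exists a strongly connected planar directed graph $D$ such that, in the game of Cops and Robbers played on $D$, three cops do not have a winning strategy; that is, the cop number of $D$ is greater than $3$.
   Context: Cops and Robbers on a directed graph $D$: both players know $D$. First the cops place $k$ cops on vertices of $D$ (several cops may share a vertex). Then the robber places himself on a vertex. The players then alternate turns, starting with the cops. On the cops' turn, each cop either stays put or moves along one directed edge (from its tail to its head), independently of the other cops. On the robber's turn, he either stays put or moves along one directed edge. The cops win if at some point a cop occupies the same vertex as the robber; the cops have a winning strategy if they can guarantee this within finitely many turns, regardless of the robber's play. The cop number of $D$ is the minimum $k$ for which the cops have a winning strategy. A directed graph is planar if its underlying undirected graph is planar, and it is strongly connected if for every ordered pair of vertices $(u,v)$ there is a directed path from $u$ to $v$. *)

(* Defs.v *)
From HB Require Import structures.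
From mathcomp Require Import all_boot all_order all_algebra.
From mathcomp Require Import all_classical all_reals all_analysis.

Set Implicit Arguments.
Unset Strict Implicit.
Unset Printing Implicit Defensive.

Import Order.TTheory GRing.Theory Num.Theory.
Import numFieldNormedType.Exports.

Local Open Scope classical_set_scope.
Local Open Scope ring_scope.

(* Finite, without loops or multiple edges; a pair of opposite edges is allowed.
   Since players may always stay put, loops would not affect the game. *)
Record digraph := Digraph {
  vertex :> finType;
  diedge : rel vertex;
  diedge_irreflexive : irreflexive diedge
}.

Definition strongly_connected (D : digraph) : Prop :=
  forall u v : D, connect (@diedge D) u v.

(* An undirected edge is the set of its two ends, so that opposite edges
   contribute a single edge. *)
Definition underlying_edges (D : digraph) : {set {set D}} :=
  [set [set p.1; p.2]%SET | p : D * D & diedge p.1 p.2]%SET.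

(* Vertices are distinct points, every edge is a Jordan arc joining the points
   of its two ends, and the interior of an edge contains no vertex and no point
   of another edge. *)
Definition plane_drawing (R : realType) (V : finType) (E : {set {set V}})
    (pos : V -> R * R) (gamma : {set V} -> R -> R * R) : Prop :=
  [/\ injective pos,
      forall e, e \in E ->
        [/\ {within `[0, 1], continuous (gamma e)},
            {in `[0, 1] &, injective (gamma e)} &
            [set gamma e 0; gamma e 1] = pos @` [set` e]],
      forall e v, e \in E -> ~ (gamma e @` `]0, 1[) (pos v) &
      forall e f, e \in E -> f \in E -> e != f ->
        (gamma e @` `]0, 1[) `&` (gamma f @` `[0, 1]) = set0].

(* realType axiomatizes the real line up to isomorphism, so quantifying over
   all its models only avoids the choice of one of them. *)
Definition planar (D : digraph) : Prop :=
  forall R : realType, exists pos gamma,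
    @plane_drawing R D (underlying_edges D) pos gamma.

Section Game.
Variable D : digraph.

Definition step (u v : D) : bool := (u == v) || diedge u v.

Definition cops (k : nat) := {ffun 'I_k -> D}.

Definition cops_step (k : nat) (c c' : cops k) : Prop :=
  forall i, step (c i) (c' i).

Definition caught (k : nat) (c : cops k) (r : D) : Prop :=
  exists i, c i = r.

(* [s [::]] is the initial placement of the cops, and [s [:: r_0; ...; r_n]]
   is their position after their move number n, when the robber has started at
   r_0 and then moved through r_1, ..., r_n.  The earlier positions of the cops
   are determined by s and the history of the robber, hence are not
   arguments. *)
Definition cop_strategy (k : nat) (s : seq D -> cops k) : Prop :=
  forall h r, cops_step (s h) (s (rcons h r)).

(* [r n] is the position of the robber after his move number n, move number 0
   being his initial placement. *)
Definition robber_play (r : nat -> D) : Prop :=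
  forall n, step (r n) (r n.+1).

(* A capture may follow a move of the robber or a move of the cops. *)
Definition winning (k : nat) (s : seq D -> cops k) : Prop :=
  forall r, robber_play r ->
    exists n, caught (s (mkseq r n)) (r n) \/ caught (s (mkseq r n.+1)) (r n).

Definition cops_win (k : nat) : Prop :=
  exists2 s : seq D -> cops k, cop_strategy s & winning s.

Lemma cops_win_card : cops_win #|D|.
Proof.
exists (fun=> [ffun i => enum_val i]) => [h r i|r _].
  by rewrite /step eqxx.
by exists 0%N; left; exists (enum_rank (r 0%N)); rewrite ffunE enum_rankK.
Qed.

Lemma cops_win_exists : exists k, `[< cops_win k >].
Proof. by exists #|D|; apply/asboolP; exact: cops_win_card. Qed.

Definition cop_number : nat := ex_minn cops_win_exists.

End Game.

(* Main.v *)
(* The digraph is the dodecahedron with every edge replaced by two opposite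
   directed paths of length 2.  The robber waits at a hub (an original vertex)
   until a cop is one step behind him; this cop is committed to enter the hub,
   so he is too late to intercept a robber leaving it.  Since the dodecahedron
   has girth 5, any other cop can intercept the robber on at most one of the
   three ways out.  With three cops, one way out is thus free, and the robber
   takes it to the next hub.  A straight-line drawing with integer coordinates
   shows planarity. *)
Require Import Defs.
From Stdlib Require Import BinInt.
From mathcomp Require Import all_boot all_order all_algebra.
From mathcomp Require Import all_classical all_reals all_analysis.
From mathcomp Require Import ring lra zify ssrZ.

Set Implicit Arguments.
Unset Strict Implicit.
Unset Printing Implicit Defensive.

Import Order.TTheory GRing.Theory Num.Theory.
Import numFieldNormedType.Exports.

(** * Endless robber plays from an invariant *)

(** [safe] is tested at the robber's turns; a response that restores it whatever the cops do next,
    iterated against a fixed strategy, gives a play without capture. *)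
Lemma robber_evades (D : digraph) (k : nat) (safe : cops D k -> D -> Prop) :
    (forall c r, safe c r -> ~ caught c r) ->
    (forall c, exists2 r, ~ caught c r &
       forall c', cops_step c c' -> safe c' r) ->
    (forall c r, safe c r -> exists2 r', step r r' /\ ~ caught c r' &
       forall c', cops_step c c' -> safe c' r') ->
  ~ cops_win D k.
Proof.
move=> safeN start move [s s_strat s_win].
have [r0 r0N r0P] := start (s [::]).
have /choice[next nextP] (x : cops D k * D) : exists r', safe x.1 x.2 ->
    [/\ step x.2 r', ~ caught x.1 r' &
      forall c', cops_step x.1 c' -> safe c' r'].
  have [/move[r' [? ?] ?]|nsafe] := pselect (safe x.1 x.2); first by exists r'.
  by exists r0.
(* [hist n] lists [r 0] to [r n], hence has n + 1 entries; the recursion is on histories because [s]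
   reads them. *)
pose hist := fix hist n : seq D :=
  if n is m.+1 then rcons (hist m) (next (s (hist m), last r0 (hist m)))
  else [:: r0].
pose r n := last r0 (hist n).
have histE n : mkseq r n.+1 = hist n.
  elim: n => [//|n IHn]; rewrite mkseqS IHn /=.
  by rewrite /r /= last_rcons.
have safe_r n : safe (s (hist n)) (r n).
  elim: n => [|n IHn]; first by apply: r0P; exact: (s_strat [::]).
  rewrite /r /= last_rcons; have [_ _] := nextP (s (hist n), r n) IHn.
  by apply; exact: s_strat.
have rS n : r n.+1 = next (s (hist n), r n) by rewrite /r /= last_rcons.
have [|n []] := s_win r.
- by move=> n; rewrite rS; have [] := nextP (s (hist n), r n) (safe_r n).
- case: n => [//|n]; rewrite histE rS.
  by have [] := nextP (s (hist n), r n) (safe_r n).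
- by rewrite histE; exact: safeN.
Qed.

(** * Relay digraphs and the escape from hub to hub *)

(* A vertex [(u, None)] is the hub [u]; the vertex [(u, Some j)] is the interior
   vertex of the path of length 2 from the hub [u] to the hub [nb u j]. *)
Section Relay.
Variables (T : finType) (d : nat) (nb : T -> 'I_d -> T).

Definition relay_edge : rel (T * option 'I_d) := fun x y =>
  if x.2 is Some j then y == (nb x.1 j, None)
  else (y.1 == x.1) && (y.2 != None).

Lemma relay_edge_irreflexive : irreflexive relay_edge.
Proof. by case=> u [j|]; rewrite /relay_edge /= ?andbF// xpair_eqE andbF. Qed.

Definition relay := Digraph relay_edge_irreflexive.

Lemma relay_strongly_connected :
    (forall u v, connect (fun u v => v \in codom (nb u)) u v) ->
  strongly_connected relay.
Proof.
move=> conn.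
have hubs u v : connect relay_edge (u, None) (v, None).
  have /connectP[p pth ->] := conn u v.
  elim: p u pth => [|w p IHp] u /=; first by rewrite connect0.
  case/andP=> /codomP[j ->] /IHp; apply: connect_trans.
  apply: (@connect_trans _ _ (u, Some j)); apply: connect1;
    by rewrite /relay_edge /= !eqxx.
move=> [u o] [v o'].
have out : exists w, connect relay_edge (u, o) (w, None).
  case: o => [j|]; last by exists u.
  by exists (nb u j); apply: connect1; rewrite /relay_edge /= eqxx.
have [w /connect_trans-> //] := out; apply: connect_trans (hubs w v) _.
case: o' => [j|]; last exact: connect0.
by apply: connect1; rewrite /relay_edge /= eqxx.
Qed.

Lemma step_hub (w : relay) a :
  step w ((a, None) : relay) =
    if w.2 is Some j then nb w.1 j == a else w.1 == a.
Proof.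
case: w => u [j|]; rewrite /step /diedge /= /relay_edge /= !xpair_eqE /=.
  by rewrite andbF andbT eq_sym.
by rewrite andbT andbF orbF.
Qed.

(** A robber leaving a hub gives the cops two moves to capture him at the next one, so these are the
    cops that can spoil the exit towards [a]. *)
Definition reaches_hub2 (w : relay) a :=
  [exists w' : relay, step w w' && step w' ((a, None) : relay)].

Lemma reaches_hub2P w a : reaches_hub2 w a ->
  if w.2 is Some j then nb w.1 j = a else w.1 = a \/ exists j, nb w.1 j = a.
Proof.
case: w => u [j|] /existsP[[u' o'] /=] /andP[].
  case/orP=> [/eqP[<- <-]|]; first by rewrite step_hub => /eqP.
  by rewrite /diedge /= /relay_edge /= => /eqP[-> ->]; rewrite step_hub => /eqP.
case/orP=> [/eqP[<- <-]|]; first by rewrite step_hub => /eqP; left.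
rewrite /diedge /= /relay_edge /= => /andP[/eqP->]; case: o' => // j _.
by rewrite step_hub => /eqP; right; exists j.
Qed.

Lemma reaches_hub2_step (w w' : relay) a :
  step w w' -> step w' ((a, None) : relay) -> reaches_hub2 w a.
Proof. by move=> ww' w'a; apply/existsP; exists w'; rewrite ww'. Qed.

Lemma step_reaches_hub2 (w : relay) a :
  step w ((a, None) : relay) -> reaches_hub2 w a.
Proof. by apply: reaches_hub2_step; rewrite /step eqxx. Qed.

Hypothesis nb_neq : forall v i, nb v i != v.
Hypothesis nb_inj : forall v, injective (nb v).
Hypothesis nb_no_triangle : forall v i j l, nb (nb v i) j != nb v l.
Hypothesis nb_no_square : forall u v i i' j j',
  nb u i = nb v j -> nb u i' = nb v j' -> i != i' -> u = v.

(** From an interior vertex only its target hub is within reach. From a hub [u] these are [u] and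
    its neighbours; two neighbours of [v] among them would close a triangle or a square. *)
Lemma reaches_hub2_inj (w : relay) v i j : w != (v, None) ->
  reaches_hub2 w (nb v i) -> reaches_hub2 w (nb v j) -> i = j.
Proof.
case: w => u [l|] wv /reaches_hub2P /= ui /reaches_hub2P /= uj.
  by apply: (@nb_inj v); rewrite -ui.
case: ui uj => [ui|[i' ui]] [uj|[j' uj]].
- by apply: (@nb_inj v); rewrite -ui.
- by have /eqP[] := nb_no_triangle v i j' j; rewrite -ui.
- by have /eqP[] := nb_no_triangle v j i' i; rewrite -uj.
- apply: contraNeq wv => ij.
  by rewrite -(nb_no_square (esym ui) (esym uj) ij).
Qed.

Variable k : nat.
Hypotheses (k_le_d : k <= d) (k_lt_T : k < #|T|).

(** Pigeonhole: if all [d] exits were spoiled, it would be by distinct cops, none of them [i0],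
    hence by at most [k - 1]. *)
Lemma free_exit (c : cops relay k) v i0 :
    ~ caught c (v, None) -> step (c i0) ((v, None) : relay) ->
  exists j, forall i, ~~ reaches_hub2 (c i) (nb v j).
Proof.
move=> ncaught threat; have cN i : c i != (v, None).
  by apply/eqP => ci; apply: ncaught; exists i.
apply: contrapT => /forallNP cover.
have /choice[f fP] j : exists i, reaches_hub2 (c i) (nb v j).
  by have /existsNP[i /negP/negPn] := cover j; exists i.
have f_inj : injective f.
  move=> i j fij; apply: (reaches_hub2_inj (cN (f i))); rewrite ?fP//.
  by rewrite fij.
(* One step from [v] but not on it, [c i0] is interior to a path into [v] and reaches no other hub
   in two steps. *)
have fN j : f j != i0.
  apply/eqP => fj; have := fP j; rewrite fj => /reaches_hub2P.
  move: threat (cN i0); rewrite step_hub; case: (c i0) => u [l|] /= /eqP->.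
    by move=> _ /esym/eqP; rewrite (negPf (nb_neq _ _)).
  by rewrite eqxx.
have : #|codom f| <= #|predC1 i0|.
  by apply/subset_leq_card/fintype.subsetP => _ /codomP[j ->]; rewrite inE fN.
rewrite card_codom// card_ord cardC1 card_ord.
by rewrite leqNgt (leq_trans _ k_le_d)// ltn_predL (leq_trans _ (ltn_ord i0)).
Qed.

(** Invariant: the robber is uncaught and, if between hubs, no cop is one step from the hub ahead,
    so he survives entering it. *)
Lemma relay_not_cops_win : ~ cops_win relay k.
Proof.
apply: (@robber_evades relay k (fun c r => ~ caught c r /\
  if r.2 is Some j then forall i, ~~ step (c i) ((nb r.1 j, None) : relay)
  else True)) => [c r []//|c|c [v [j|]] [ncaught] /= far].
(* A cop can step onto at most one hub, so [k < #|T|] leaves a safe starting hub. *)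
- have [v vP] : exists v, forall i, ~~ step (c i) ((v, None) : relay).
    apply: contrapT => /forallNP cover.
    have /choice[f fP] v : exists i, step (c i) ((v, None) : relay).
      by have /existsNP[i /negP/negPn] := cover v; exists i.
    have /leq_card : injective f.
      move=> u v fuv; have := fP u; have := fP v; rewrite fuv !step_hub.
      by case: (c (f v)) => ? [?|] /eqP<- /eqP<-.
    by rewrite card_ord leqNgt k_lt_T.
  exists (v, None) => [[i ci]|c' cc']; first by have := vP i; rewrite ci /step eqxx.
  by split=> // -[i ci]; have := cc' i; rewrite ci (negPf (vP i)).
- exists (nb v j, None).
    split=> [|[i ci]]; last by have := far i; rewrite ci /step eqxx.
    by rewrite step_hub /= eqxx.
  by move=> c' cc'; split=> // -[i ci]; have := cc' i; rewrite ci (negPf (far i)).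
- have [[i0 threat]|/forallNP safe] :=
    pselect (exists i, step (c i) ((v, None) : relay)); last first.
    exists (v, None); first by rewrite /step eqxx.
    by move=> c' cc'; split=> // -[i ci]; apply: (safe i); rewrite -ci.
  have [j jP] := free_exit ncaught threat.
  exists (v, Some j).
    split=> [|[i ci]]; first by rewrite /step /diedge /= /relay_edge /= eqxx orbT.
    by have /negP[] := jP i; apply: step_reaches_hub2; rewrite ci step_hub /= eqxx.
  move=> c' cc'; have c'N i : ~~ step (c' i) ((nb v j, None) : relay).
    by apply: contra (jP i); apply: reaches_hub2_step.
  (* A cop on [(v, Some j)] would be one step from the hub ahead, so [c'N] also excludes capture. *)
  by split=> // -[i ci]; have := c'N i; rewrite ci step_hub /= eqxx.
Qed.

End Relay.

(** * Planarity from straight-line drawings *)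

Local Open Scope ring_scope.

(** Twice the signed area of the triangle [a], [b], [c]. *)
Definition orient (R : comPzRingType) (a b c : R * R) : R :=
  (b.1 - a.1) * (c.2 - a.2) - (b.2 - a.2) * (c.1 - a.1).

(* Two reals of the same weak sign, not both zero. *)
Definition same_side (R : realDomainType) (x y : R) : bool :=
  (0 <= x * y) && (x + y != 0).

(** Weak signs admit segments with a common end. *)
Definition noncrossing (R : realDomainType) (a b c d : R * R) : bool :=
  same_side (orient a b c) (orient a b d) ||
  same_side (orient c d a) (orient c d b).

Section Segment.
Variable R : realFieldType.
Implicit Types (a b c d : R * R) (s t x y : R).

Definition segment a b t : R * R :=
  ((1 - t) * a.1 + t * b.1, (1 - t) * a.2 + t * b.2).

Lemma segment0 a b : segment a b 0 = a.
Proof. by case: a => a1 a2; congr pair => /=; ring. Qed.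

Lemma segment1 a b : segment a b 1 = b.
Proof. by case: b => b1 b2; congr pair => /=; ring. Qed.

Lemma orient_segment a b c d s :
  orient a b (segment c d s) = (1 - s) * orient a b c + s * orient a b d.
Proof. by rewrite /orient /=; ring. Qed.

Lemma orient_segmentxx a b t : orient a b (segment a b t) = 0.
Proof. by rewrite /orient /=; ring. Qed.

Lemma segment_inj a b s t : a != b -> segment a b s = segment a b t -> s = t.
Proof.
case: a b => [a1 a2] [b1 b2] ab [e1 e2]; apply: contraNeq ab => st.
have st0 : s - t != 0 by rewrite subr_eq0.
rewrite xpair_eqE -!(subr_eq0 _ b1) -!(subr_eq0 _ b2).
have h1 : (s - t) * (a1 - b1) = 0 by move: e1 => /=; lra.
have h2 : (s - t) * (a2 - b2) = 0 by move: e2 => /=; lra.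
by move/eqP: h1 h2; rewrite mulf_eq0 (negPf st0) => /= -> /eqP;
  rewrite mulf_eq0 (negPf st0).
Qed.

Lemma same_side_segment x y s : same_side x y -> 0 <= s <= 1 ->
  (1 - s) * x + s * y = 0 -> s = 0 \/ s = 1.
Proof.
move=> /andP[xy0 xyN0] /andP[s0 s1] e.
have [->|sN0] := eqVneq s 0; first by left.
have [->|sN1] := eqVneq s 1; first by right.
have s_gt0 : 0 < s by rewrite lt_def sN0.
have s_lt1 : 0 < 1 - s by rewrite subr_gt0 lt_def eq_sym sN1.
case/eqP: xyN0.
have e' : (1 - s) * x = - (s * y) by lra.
(* Multiplying [e'] by [x] bounds [(1 - s) * x ^+ 2] by [- s * (x * y)], which is at most 0. *)
have x0 : x = 0.
  have : (1 - s) * x ^+ 2 <= 0.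
    by rewrite expr2 mulrA e' mulNr oppr_le0 -mulrA mulr_ge0// mulrC.
  by rewrite pmulr_rle0// real_exprn_even_le0 ?num_real//= => /eqP.
move: e; rewrite x0 mulr0 !add0r => /eqP; rewrite mulf_eq0 gt_eqF//=.
by move/eqP.
Qed.

(** At a common point, [orient a b] vanishes along the second segment and [orient c d] along the
    first; one of these affine functions can vanish only at an end. *)
Lemma noncrossing_segment a b c d t s : noncrossing a b c d ->
    0 < t < 1 -> 0 <= s <= 1 -> segment a b t = segment c d s ->
  s = 0 \/ s = 1.
Proof.
move=> /orP[ss _ s01 e|ss /andP[t0 t1] _ e].
  apply: (same_side_segment ss s01).
  by rewrite -orient_segment -e orient_segmentxx.
have : t = 0 \/ t = 1.
  apply: (same_side_segment ss); first by rewrite !ltW.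
  by rewrite -orient_segment e orient_segmentxx.
by case=> e'; move: t0 t1; rewrite e' ltxx.
Qed.

End Segment.

Lemma continuous_segment (R : realType) (a b : R * R) :
  continuous (segment a b).
Proof.
have lin (x y : R) : continuous (fun t : R => (1 - t) * x + t * y).
  move=> t; apply: cvgD; apply: cvgM; [|exact: cvg_cst|exact: cvg_id|exact: cvg_cst].
  by apply: cvgB; [exact: cvg_cst|exact: cvg_id].
move=> t; exact: cvg_pair (lin _ _ _) (lin _ _ _).
Qed.

(** Over [Z] the hypotheses are sign checks that can be computed. Contact with the interior of an
    arc could only occur at an end of the other, but no vertex lies there. *)
Lemma planar_straight (D : digraph) (pos : D -> Z * Z) :
    injective pos ->
    (forall a b c : D, diedge a b -> c != a -> c != b ->
       orient (pos a) (pos b) (pos c) != 0) ->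
    (forall a b c d : D, diedge a b -> diedge c d ->
       (a, b) != (c, d) -> (a, b) != (d, c) ->
       noncrossing (pos a) (pos b) (pos c) (pos d)) ->
  planar D.
Proof.
move=> pos_inj pos_gen pos_nc R.
(* [f] is a ring morphism that preserves and reflects signs, so the checks transfer to every [R]. *)
pose f : Z -> R := intr \o int_of_Z.
have f_ge0 z : (0 <= f z) = (0 <= z) by rewrite /f /= ler0z; case: z.
have fB : {morph f : x y / x - y} by move=> x y; rewrite /f rmorphB.
have fD : {morph f : x y / x + y} by move=> x y; rewrite /f rmorphD.
have fM : {morph f : x y / x * y} by move=> x y; rewrite /f rmorphM.
have f_eq0 z : (f z == 0) = (z == 0).
  by rewrite /f /= intr_eq0; case: z => [|p|p] //=; lia.
pose P (v : D) : R * R := (f (pos v).1, f (pos v).2).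
have orientP a b c : orient (P a) (P b) (P c) = f (orient (pos a) (pos b) (pos c)).
  by rewrite /orient /P /= fB !fM !fB.
have ssP x y : same_side (f x) (f y) = same_side x y.
  by rewrite /same_side -fM -fD f_ge0 f_eq0.
have P_inj : injective P.
  move=> u v [/eqP]; rewrite -subr_eq0 -fB f_eq0 subr_eq0 => /eqP e1.
  move=> /eqP; rewrite -subr_eq0 -fB f_eq0 subr_eq0 => /eqP e2.
  by apply: pos_inj; rewrite [LHS]surjective_pairing e1 e2 -surjective_pairing.
have P_edge a b : diedge a b -> P a != P b.
  move=> ab; apply/eqP => /P_inj e; move: ab.
  by rewrite e diedge_irreflexive.
(* An edge is parametrized along some arc that induces it; the value off the edges is a dummy. *)
pose gamma (e : {set D}) : R -> R * R :=
  if [pick p : D * D | diedge p.1 p.2 && (e == [set p.1; p.2]%SET)] is Some p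
  then segment (P p.1) (P p.2) else fun=> (0, 0).
have gammaP e : e \in underlying_edges D -> exists a b : D,
    [/\ diedge a b, e = [set a; b]%SET & gamma e = segment (P a) (P b)].
  case/imsetP=> -[a b]; rewrite inE => ab ->; rewrite /gamma.
  case: pickP => [[a' b'] /andP[ab' /eqP ab'E]|/(_ (a, b))].
    by exists a', b'.
  by rewrite ab eqxx.
have vertex_off (a b v : D) t : diedge a b -> 0 < t < 1 ->
    segment (P a) (P b) t <> P v.
  move=> ab /andP[t0 t1] e; have [va|va] := eqVneq v a.
    have := segment_inj (P_edge _ _ ab) (etrans e _ : _ = segment _ _ 0).
    by rewrite segment0 va => /(_ erefl) t00; rewrite t00 ltxx in t0.
  have [vb|vb] := eqVneq v b.
    have := segment_inj (P_edge _ _ ab) (etrans e _ : _ = segment _ _ 1).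
    by rewrite segment1 vb => /(_ erefl) t11; rewrite t11 ltxx in t1.
  have /negP[] := pos_gen _ _ _ ab va vb.
  by rewrite -f_eq0 -orientP -e orient_segmentxx.
exists P, gamma; split=> //.
- move=> e /gammaP[a [b [ab -> ->]]]; split.
  + by apply: continuous_subspaceT; exact: continuous_segment.
  + by move=> s t _ _; apply: segment_inj; exact: P_edge.
  + rewrite segment0 segment1; apply/seteqP; split=> [_ [|] ->|_ [v + <-]].
    * by exists a => //=; rewrite !inE eqxx.
    * by exists b => //=; rewrite !inE eqxx orbT.
    * by rewrite /= !inE => /orP[] /eqP->; [left|right].
- move=> e v /gammaP[a [b [ab _ ->]]] [t]; rewrite /= in_itv /= => t01.
  exact: vertex_off.
- move=> e e' /gammaP[a [b [ab -> ->]]] /gammaP[c [d [cd -> ->]]] ee'.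
  apply/seteqP; split=> // _ [[t + <-] [s]]; rewrite /= !in_itv /= => t01 s01 E.
  have ne1 : (a, b) != (c, d) by apply: contraNneq ee' => -[-> ->].
  have ne2 : (a, b) != (d, c).
    by apply: contraNneq ee' => -[-> ->]; rewrite finset.setUC.
  have nc : noncrossing (P a) (P b) (P c) (P d).
    by rewrite /noncrossing !orientP !ssP; exact: pos_nc.
  by case: (noncrossing_segment nc t01 s01 (esym E)) => s_eq;
    move: E; rewrite s_eq ?segment0 ?segment1 => /esym; exact: vertex_off.
Qed.

Local Close Scope ring_scope.

(** * The dodecahedral graph *)

(* The dodecahedron in LCF notation [10,7,4,-4,-7,10,-4,7,-7,4]^2: the vertices
   are numbered along a Hamiltonian cycle and the third neighbour of [i] is
   obtained by adding the [i]-th offset modulo 20. *)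
Definition dodeca_nb_nat (i j : nat) : nat :=
  (i + nth 0 [:: 1; 19;
     nth 0 [:: 10; 7; 4; 16; 13; 10; 16; 7; 13; 4] (i %% 10)] j) %% 20.

Definition dodeca_nb (i : 'I_20) (j : 'I_3) : 'I_20 :=
  Ordinal (@ltn_pmod _ 20 isT : dodeca_nb_nat i j < 20).

(** Lets [vm_compute] settle claims about ordinals by a search over natural numbers. *)
Lemma all_iota_ord n (P : pred nat) :
  all P (iota 0 n) -> forall i : 'I_n, P i.
Proof. by move/allP=> allP i; apply: allP; rewrite mem_iota ltn_ord. Qed.

Lemma dodeca_nb_neq v i : dodeca_nb v i != v.
Proof.
rewrite -val_eqE; move: v i.
pose P v i := dodeca_nb_nat v i != v.
suff: all (fun v => all (P v) (iota 0 3)) (iota 0 20).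
  by move=> H v i; exact: all_iota_ord (all_iota_ord H v) i.
by vm_compute.
Qed.

Lemma dodeca_nb_inj v : injective (dodeca_nb v).
Proof.
move=> i j /(congr1 val) /= /eqP e; apply/val_inj/eqP; move: v i j e.
pose P v i j := (dodeca_nb_nat v i == dodeca_nb_nat v j) ==> (i == j).
suff: all (fun v => all (fun i => all (P v i) (iota 0 3)) (iota 0 3)) (iota 0 20).
  move=> H v i j; apply/implyP.
  exact: all_iota_ord (all_iota_ord (all_iota_ord H v) i) j.
by vm_compute.
Qed.

Lemma dodeca_no_triangle v i j l :
  dodeca_nb (dodeca_nb v i) j != dodeca_nb v l.
Proof.
rewrite -val_eqE; move: v i j l.
pose P v i j l :=
  dodeca_nb_nat (dodeca_nb_nat v i) j != dodeca_nb_nat v l.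
suff: all (fun v => all (fun i => all (fun j => all (P v i j)
    (iota 0 3)) (iota 0 3)) (iota 0 3)) (iota 0 20).
  move=> H v i j l.
  exact: all_iota_ord (all_iota_ord (all_iota_ord (all_iota_ord H v) i) j) l.
by vm_compute.
Qed.

Lemma dodeca_no_square u v i i' j j' :
    dodeca_nb u i = dodeca_nb v j -> dodeca_nb u i' = dodeca_nb v j' ->
  i != i' -> u = v.
Proof.
move=> /(congr1 val) /= /eqP e /(congr1 val) /= /eqP e' ii'.
apply/val_inj/eqP; move: ii' e e'; rewrite -val_eqE /=; move: u v i i' j j'.
pose P u v i i' j j' := [&& i != i', dodeca_nb_nat u i == dodeca_nb_nat v j &
  dodeca_nb_nat u i' == dodeca_nb_nat v j'] ==> (u == v).
suff: all (fun u => all (fun v => all (fun i => all (fun i' => all (fun j =>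
    all (P u v i i' j) (iota 0 3)) (iota 0 3)) (iota 0 3)) (iota 0 3))
    (iota 0 20)) (iota 0 20).
  move=> H u v i i' j j' ii' e e'.
  have := all_iota_ord (all_iota_ord (all_iota_ord (all_iota_ord
    (all_iota_ord (all_iota_ord H u) v) i) i') j) j'.
  by rewrite /P ii' e e'.
by vm_compute.
Qed.

(** Neighbour [0] is the successor on the Hamiltonian cycle. *)
Lemma dodeca_connected u v :
  connect (fun u v => v \in codom (dodeca_nb u)) u v.
Proof.
have forward n : connect (fun u v => v \in codom (dodeca_nb u)) u (inZp (u + n)).
  elim: n => [|n /connect_trans]; first by rewrite addn0 valZpK connect0.
  apply; apply: connect1; apply/codomP; exists ord0; apply/val_inj => /=.
  rewrite /dodeca_nb_nat /= addnS -addn1 modnDml.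
  by rewrite -addnA addn1.
(* Adding 20 keeps the subtraction of [u] from truncating. *)
have <- : inZp (u + (20 + v - u)) = v.
  apply/val_inj; rewrite /= subnKC; first by rewrite modnDl modn_small.
  by apply: leq_trans (leq_addr _ _); exact: ltnW.
exact: forward.
Qed.

(** * An integer drawing of the relay of the dodecahedron *)

Local Open Scope ring_scope.

(** The outer pentagon is 0, 1, 2, 3, 19 and the inner one 12 to 16; the other ten vertices form a
    cycle between them. *)
Definition dodeca_point (i : nat) : Z * Z :=
  nth (0, 0) [:: (0, 8); (8, 2); (5, -6); (-5, -6); (-3, -5);
    (0, -4); (3, -5); (4, -1); (5, 2); (2, 3);
    (0, 6); (-2, 3); (-1, 2); (1, 2); (2, -1);
    (0, -2); (-2, -1); (-4, -1); (-5, 2); (-8, 2)] i.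

(* Pairs encode the vertices: [(i, 0)] is the hub [i] and [(i, j.+1)] the
   interior vertex of the path from [i] to its [j]-th neighbour, which is drawn
   slightly to the left of the middle of that edge. *)
Definition relay_point (x : nat * nat) : Z * Z :=
  let p := dodeca_point x.1 in
  if x.2 is j.+1 then
    let q := dodeca_point (dodeca_nb_nat x.1 j) in
    (15 * (p.1 + q.1) - (q.2 - p.2), 15 * (p.2 + q.2) + (q.1 - p.1))
  else (30 * p.1, 30 * p.2).

Definition relay_codes : seq (nat * nat) :=
  [seq (i, k) | i <- iota 0 20, k <- iota 0 4].

Definition relay_arcs : seq ((nat * nat) * (nat * nat)) :=
  [seq ((i, 0%N), (i, j.+1)) | i <- iota 0 20, j <- iota 0 3] ++
  [seq ((i, j.+1), (dodeca_nb_nat i j, 0%N)) | i <- iota 0 20, j <- iota 0 3].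

Definition relay_code (x : relay dodeca_nb) : nat * nat :=
  (val x.1, if x.2 is Some j then j.+1 else 0%N).

Lemma relay_code_inj : injective relay_code.
Proof.
by move=> [i [j|]] [i' [j'|]] [] => [/val_inj-> /val_inj->|||/val_inj->].
Qed.

Lemma mem_relay_code x : relay_code x \in relay_codes.
Proof.
case: x => i o; apply/allpairsP; exists (relay_code (i, o)).
by rewrite !mem_iota /= ltn_ord; case: o => [j|] //=; rewrite ltnS ltn_ord.
Qed.

Lemma mem_relay_arc (x y : relay dodeca_nb) :
  diedge x y -> (relay_code x, relay_code y) \in relay_arcs.
Proof.
case: x y => i [j|] [i' o]; rewrite /diedge /= /relay_edge /= mem_cat.
  move=> /eqP[-> ->]; apply/orP; right; apply/allpairsP; exists (val i, val j).
  by rewrite !mem_iota /= !ltn_ord.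
case: o => [j|]; last by rewrite andbF.
move=> /andP[/eqP-> _]; apply/orP; left; apply/allpairsP; exists (val i, val j).
by rewrite !mem_iota /= !ltn_ord.
Qed.

Lemma relay_points_distinct :
  all (fun x => all (fun y => (relay_point x == relay_point y) ==> (x == y))
    relay_codes) relay_codes.
Proof. by vm_compute. Qed.

Lemma relay_points_off_arcs :
  all (fun a => all (fun x => [|| x == a.1, x == a.2 |
      orient (relay_point a.1) (relay_point a.2) (relay_point x) != 0])
    relay_codes) relay_arcs.
Proof. by vm_compute. Qed.

Lemma relay_arcs_noncrossing :
  all (fun a => all (fun b => [|| a == b, a == (b.2, b.1) |
      noncrossing (relay_point a.1) (relay_point a.2)
        (relay_point b.1) (relay_point b.2)])
    relay_arcs) relay_arcs.
Proof. by vm_compute. Qed.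

Lemma dodeca_relay_planar : planar (relay dodeca_nb).
Proof.
apply: (@planar_straight _ (relay_point \o relay_code)).
- move=> x y /eqP e; apply/relay_code_inj/eqP.
  have /allP/(_ _ (mem_relay_code x)) := relay_points_distinct.
  by move=> /allP/(_ _ (mem_relay_code y)) /implyP; apply.
- move=> a b c ab ca cb.
  have /allP/(_ _ (mem_relay_arc ab)) := relay_points_off_arcs.
  move=> /allP/(_ _ (mem_relay_code c)) /=.
  by rewrite !(inj_eq relay_code_inj) (negPf ca) (negPf cb).
- move=> a b c d ab cd e e'.
  have /allP/(_ _ (mem_relay_arc ab)) := relay_arcs_noncrossing.
  move=> /allP/(_ _ (mem_relay_arc cd)) /=.
  rewrite !(xpair_eqE (relay_code _) (relay_code _)) !(inj_eq relay_code_inj).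
  by move: e e'; rewrite !xpair_eqE => /negPf-> /negPf->.
Qed.

Local Close Scope ring_scope.

Theorem theorem1 :
  exists D : digraph,
    [/\ 0 < #|D|, strongly_connected D, planar D,
        ~ cops_win D 3 & 3 < cop_number D].
Proof.
(* All [k <= 3] are treated at once, since [cop_number] is the least winning number. *)
have cops_lose k : k <= 3 -> ~ cops_win (relay dodeca_nb) k.
  move=> k3; apply: relay_not_cops_win => //.
  - exact: dodeca_nb_neq.
  - exact: dodeca_nb_inj.
  - exact: dodeca_no_triangle.
  - exact: dodeca_no_square.
  - by rewrite card_ord (leq_ltn_trans k3).
exists (relay dodeca_nb); split.
- by apply/card_gt0P; exists (ord0, None).
- exact: relay_strongly_connected dodeca_connected.
- exact: dodeca_relay_planar.
- exact: cops_lose.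
- rewrite /cop_number; case: ex_minnP => k /asboolP k_win _.
  by rewrite ltnNge; apply/negP => /cops_lose.
Qed.
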